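(* Let $G$ be a group, let $V$ be a finite-dimensional unitary representation of $G$, and let $\xi$ be an irreducible representation of $G$. Let $\mathcal{I} \subset V$ be a subspace with orthogonal projector $\Omega$, and suppose that $\mathcal{I}$ satisfies the Knill--Laflamme condition for all errors in the $\xi$-isotypic subspace $W_\xi \subset \mathcal{L}(V)$, i.e. for every $F \in W_\xi$ there is a scalar $c_F \in \mathbb{C}$ with $\Omega F \Omega = c_F \Omega$. Then for every unitary representation $\mathcal{H}$ of $G$ and every $G$-equivariant isometric embedding $\mathcal{U} : V \hookrightarrow \mathcal{H}$, the subspace $\mathcal{C} = \mathcal{U}(\mathcal{I}) \subset \mathcal{H}$, with orthogonal projector $\Pi$, satisfies the Knill--Laflamme condition for all errors in the $\xi$-isotypic subspace $K_\xi \subset \mathcal{L}(\mathcal{H})$, i.e. for every $E \in K_\xi$ there is a scalar $c_E \in \mathbb{C}$ with $\Pi E \Pi = c_E \Pi$.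
   Context: Representations are on complex Hilbert spaces. $\mathcal{L}(V)$ and $\mathcal{L}(\mathcal{H})$ denote the spaces of (bounded) linear operators on $V$ and $\mathcal{H}$, viewed as $G$-representations under conjugation: $g$ acts on $F \in \mathcal{L}(V)$ by $F \mapsto \rho_V(g) F \rho_V(g)^{-1}$, and similarly on $\mathcal{L}(\mathcal{H})$ with $\rho_{\mathcal{H}}$, where $\rho_V$ and $\rho_{\mathcal{H}}$ denote the two representations. The $\xi$-isotypic subspace $W_\xi$ of $\mathcal{L}(V)$ (resp. $K_\xi$ of $\mathcal{L}(\mathcal{H})$) is the sum of all subrepresentations of $\mathcal{L}(V)$ (resp. $\mathcal{L}(\mathcal{H})$) isomorphic to $\xi$. A $G$-equivariant isometric embedding is a linear map $\mathcal{U} : V \to \mathcal{H}$ with $\mathcal{U}^\dagger \mathcal{U} = \mathbf{1}_V$ and $\mathcal{U}\rho_V(g) = \rho_{\mathcal{H}}(g)\mathcal{U}$ for all $g \in G$. *)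

(* Defs.v *)
From HB Require Import structures.
Set Warnings "-notation-overridden,-ambiguous-paths,-notation-incompatible-prefix".
From mathcomp Require Export all_boot all_order all_algebra sesquilinear complex.
From mathcomp Require Export boolp classical_sets functions reals.
From mathcomp Require Export topology normedtype.

Set Implicit Arguments.
Unset Strict Implicit.
Unset Printing Implicit Defensive.

Import Order.TTheory GRing.Theory Num.Theory.
Import numFieldNormedType.Exports.

Local Open Scope classical_set_scope.
Local Open Scope complex_scope.
Local Open Scope ring_scope.

(* The inner product is linear in its first argument and conjugate-linear in
   the second; completeness is that of the underlying normed module. *)
HB.mixin Record isHilbert (R : realType) (H : Type)
    of CompleteNormedModule R[i] H := {
  inner : {dot H for Num.conj};
  innerE : forall x : H, inner x x = `|x| ^+ 2
}.

#[short(type="hilbertType")]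
HB.structure Definition Hilbert (R : realType) :=
  {H of isHilbert R H & CompleteNormedModule R[i] H}.

Section LinearAlgebra.
Context {K : pzRingType}.

Definition linear_subspace (W : lmodType K) (A : set W) : Prop :=
  A 0 /\ forall (a : K) (u v : W), A u -> A v -> A (a *: u + v).

(* The sum of a family of subspaces is algebraic: it is the set of finite sums
   (no closure), and it is {0} for the empty family. *)
Definition subspace_sum (W : lmodType K) (P : set (set W)) : set W :=
  [set w | exists (n : nat) (f : 'I_n -> W),
     (forall i, exists2 A, P A & A (f i)) /\ w = \sum_(i < n) f i].

Definition finite_dimensional (W : lmodType K) : Prop :=
  exists (n : nat) (e : 'I_n -> W),
    forall w, exists c : 'I_n -> K, w = \sum_(i < n) c i *: e i.

End LinearAlgebra.

Section Operators.
Context {R : realType}.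
Implicit Types U V H : hilbertType R.

(* Operators are plain functions, so that linear combinations are taken in the
   pointwise [lmodType] structure of [U -> V]. *)
Definition bounded_operators U V : set (U -> V) :=
  [set F | linear F /\ continuous F].
Arguments bounded_operators : clear implicits.

(* Norms of a module over [R[i]] take values in [R[i]], whence the real parts. *)
Definition opnorm U V (F : U -> V) : R :=
  sup [set complex.Re `|F x| | x in [set x : U | `|x| <= 1]].

Definition is_adjoint U V (F : U -> V) (F' : V -> U) : Prop :=
  forall x y, inner (F x) y = inner x (F' y).

Definition orthogonal_projector H (A : set H) (P : H -> H) : Prop :=
  [/\ bounded_operators H H P, P \o P = P, is_adjoint P P & range P = A].

Definition isometric_embedding V H (U : V -> H) : Prop :=
  linear U /\ exists2 Ud : H -> V, is_adjoint U Ud & Ud \o U = id.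

Definition Knill_Laflamme H (P : H -> H) (S : set (H -> H)) : Prop :=
  forall F, S F -> exists c : R[i], P \o F \o P = c *: P.

End Operators.

Arguments bounded_operators {R} U V.

Section Representations.
Context {R : realType} {G : groupType}.
Implicit Types X V H : hilbertType R.

Record representation H := Representation {
  rep_fun :> G -> H -> H;
  rep_bounded : forall g, bounded_operators H H (rep_fun g);
  rep1 : rep_fun 1%g = id;
  repM : forall g h, rep_fun (g * h)%g = rep_fun g \o rep_fun h
}.

Definition unitary H (rho : representation H) : Prop :=
  forall g, is_adjoint (rho g) (rho g^-1%g).

(* On a Hilbert space only closed invariant subspaces are excluded; closedness
   is automatic in finite dimension. *)
Definition irreducible_rep X (xi : representation X) : Prop :=
  (exists x : X, x != 0) /\
  forall A : set X, linear_subspace A -> closed A ->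
    (forall g x, A x -> A (xi g x)) -> A = [set 0] \/ A = setT.

Definition equivariant V H (rhoV : representation V) (rhoH : representation H)
    (U : V -> H) : Prop :=
  forall g, U \o rhoV g = rhoH g \o U.

Definition conj_action H (rho : representation H) (g : G) (F : H -> H) :
    H -> H :=
  rho g \o F \o rho g^-1%g.

Definition operator_subrep H (rho : representation H) (K : set (H -> H)) :
    Prop :=
  [/\ linear_subspace K, K `<=` bounded_operators H H
    & forall g F, K F -> K (conj_action rho g F)].

(* Isomorphisms are equivariant linear bijections that are homeomorphisms for
   the operator norm on [K]; in particular [K] is then norm-closed. If [X] is
   finite-dimensional, the norm bounds hold for every linear bijection. *)
Definition isomorphic_to_subrep X H (xi : representation X)
    (rho : representation H) (K : set (H -> H)) : Prop :=
  exists T : X -> H -> H,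
    [/\ linear T, set_bij setT K T,
        forall g x, T (xi g x) = conj_action rho g (T x)
      & exists m M : R, 0 < m /\ forall x,
          m * complex.Re `|x| <= opnorm (T x) <= M * complex.Re `|x|].

Definition isotypic X H (xi : representation X) (rho : representation H) :
    set (H -> H) :=
  subspace_sum
    [set K | operator_subrep rho K /\ isomorphic_to_subrep xi rho K].

End Representations.

Arguments representation {R} G H.

(* Main.v *)
(* Compression by the embedding, F |-> U^dag F U, is a bounded equivariant map
   from L(H) to L(V). By Schur's lemma it either kills a subrepresentation of
   L(H) isomorphic to xi or maps it onto a subrepresentation of L(V) isomorphic
   to xi, so it sends K_xi into W_xi. Since Pi = U Omega U^dag, one gets
   Pi E Pi = U (Omega (U^dag E U) Omega) U^dag = c Pi. *)
From HB Require Import structures.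
Require Import Defs.
From mathcomp Require Import ring.

Set Implicit Arguments.
Unset Strict Implicit.
Unset Printing Implicit Defensive.

Import Order.TTheory GRing.Theory Num.Theory.
Import numFieldNormedType.Exports.

Local Open Scope classical_set_scope.
Local Open Scope complex_scope.
Local Open Scope ring_scope.

(* Induction on the list of functionals: if [psi a] does not vanish at some
   common zero x0 of the others, subtracting a multiple of [psi a] from [f]
   makes [f] vanish on the common zeros of the others. *)
Lemma factor_through_functionals (K : fieldType) (X Z : lmodType K)
    (J : finType) (psi : J -> X -> K) (f : X -> Z) :
  (forall j, linear_for *%R (psi j)) -> linear f ->
  (forall x, (forall j, psi j x = 0) -> f x = 0) ->
  exists z : J -> Z, forall x, f x = \sum_j psi j x *: z j.
Proof.
move=> psiL fL fker; pose ker (s : seq J) x := forall j, j \in s -> psi j x = 0.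
suff indJ : forall s f, linear f -> (forall x, ker s x -> f x = 0) ->
    exists z : J -> Z, forall x, f x = \sum_j psi j x *: z j.
  apply: (indJ (index_enum J) f fL) => x kx; apply: fker => j; apply: kx.
  exact: mem_index_enum.
elim=> [|a s IHs] {fL fker}{}f fL fker.
  exists (fun=> 0) => x.
  rewrite big1 => [|j _]; last by rewrite scaler0.
  exact: fker.
have [[x0 kx0 x0a]|no] := pselect (exists2 x, ker s x & psi a x != 0); last first.
  apply: IHs fL _ => x kx; apply: fker => j.
  rewrite inE => /predU1P[->|]; last exact: kx.
  by apply: contra_notP no => /eqP ?; exists x.
pose w := (psi a x0)^-1 *: f x0.
have [||z zE] := IHs (fun x => f x - psi a x *: w).
- by move=> c u v; rewrite fL psiL scalerDl opprD addrACA scalerBr -scalerA.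
- move=> x kx; rewrite /w scalerA addrC -scaleNr.
  (* Moving [x] along [x0] until [psi a] vanishes stays in [ker s]; [f] is zero at the resulting
     point, which gives [f x = psi a x *: w]. *)
  have := fker (- (psi a x / psi a x0) *: x0 + x).
  rewrite fL; apply=> j; rewrite inE psiL => /predU1P[->|js].
    by rewrite mulNr divfK // addNr.
  by rewrite (kx0 j js) (kx j js) mulr0 addr0.
(* The weight [z a] need not be zero, so [w] is added to it. *)
exists (fun j => z j + (if j == a then w else 0)) => x.
rewrite -[LHS](subrK (psi a x *: w)) zE.
under [RHS]eq_bigr do rewrite scalerDr.
rewrite big_split /=; congr (_ + _).
by rewrite (bigD1 a) //= eqxx big1 ?addr0 // => j /negPf->; rewrite scaler0.
Qed.

(** Operators are plain functions whose linearity is a hypothesis; bundling them gives access to the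
    library lemmas on linear maps. *)
Definition linear_of (K : pzRingType) (U V : lmodType K) (F : U -> V)
    (F_linear : linear F) : {linear U -> V} :=
  HB.pack F (GRing.isLinear.Build K U V *:%R F F_linear).

Lemma linear_fun0 (K : pzRingType) (U V : lmodType K) (F : U -> V) :
  linear F -> F 0 = 0.
Proof. by move=> FL; exact: (raddf0 (linear_of FL)). Qed.

Lemma linear_funZ (K : pzRingType) (U V : lmodType K) (F : U -> V) a u :
  linear F -> F (a *: u) = a *: F u.
Proof. by move=> FL; exact: (linearZ_LR (linear_of FL)). Qed.

Lemma linear_fun_sum (K : pzRingType) (U V : lmodType K) (F : U -> V)
    (n : nat) (f : 'I_n -> U) :
  linear F -> F (\sum_(i < n) f i) = \sum_(i < n) F (f i).
Proof. by move=> FL; exact: (raddf_sum (linear_of FL)). Qed.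

(** * Adjoints, operator norm and projectors on Hilbert spaces *)

Section HilbertSpace.
Variable R : realType.
Implicit Types U V H X : hilbertType R.

Lemma innerC H (x y : H) : inner x y = Num.conj (inner y x).
Proof. by rewrite hermC /= expr0 mul1r. Qed.

Lemma inner_inj H (y z : H) : (forall x, inner x y = inner x z) -> y = z.
Proof.
move=> yz; apply/eqP; rewrite -subr_eq0 -(dnorm_eq0 inner).
by rewrite linearBr /= yz subrr.
Qed.

(** For [v] nonzero, expand the nonnegative squared norm of [u] minus its projection onto the line
    spanned by [v]. *)
Lemma cauchy_schwarz H (u v : H) : `|inner u v| <= `|u| * `|v|.
Proof.
have [->|v0] := eqVneq v 0; first by rewrite linear0r !normr0 mulr0.
have v2 : 0 < `|v| ^+ 2 by rewrite exprn_gt0 // normr_gt0.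
rewrite -(@ler_pXn2r _ 2) ?nnegrE ?mulr_ge0 // exprMn.
have := dnorm_ge0 inner (u - (inner u v / `|v| ^+ 2) *: v).
rewrite dnormB dnormZ !innerE linearZr_LR /=.
set a := inner u v; set N := `|v| ^+ 2 in v2 *.
have NJ : Num.conj N = N by rewrite conj_Creal ?gtr0_real.
have aNJ : Num.conj (a / N) * a = `|a| ^+ 2 / N.
  by rewrite rmorphM fmorphV /= NJ mulrAC normCK [a * _]mulrC.
rewrite aNJ conj_Creal ?rpredM ?rpredV ?rpredX ?normr_real ?gtr0_real //.
rewrite normf_div expr_div_n (gtr0_norm v2).
rewrite [_ / N ^+ 2 * N](_ : _ = `|a| ^+ 2 / N); last first.
  by field; rewrite lt0r_neq0.
by rewrite opprD addrA addrK subr_ge0 ler_pdivrMr.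
Qed.
Lemma adjointC U V (F : U -> V) (F' : V -> U) :
  is_adjoint F F' -> is_adjoint F' F.
Proof. by move=> FF' x y; rewrite innerC -FF' -innerC. Qed.

Lemma adjoint_linear U V (F : U -> V) (F' : V -> U) : is_adjoint F F' -> linear F'.
Proof.
move=> FF' a u v; apply: inner_inj => x.
by rewrite -FF' !linearPr /= !FF'.
Qed.

Lemma bounded_operatorP U V (F : U -> V) :
  bounded_operators U V F <->
  linear F /\ exists c : R, forall x, `|F x| <= c%:C * `|x|.
Proof.
split=> -[FL]; pose f := linear_of FL.
  move=> /(linear_bounded_continuous f)/linear_boundedP/pinfty_ex_gt0[c c0 Fc].
  (* The constant [c] is a positive element of [R[i]], hence real. *)
  split=> //; exists (complex.Re c) => x; rewrite RRe_real ?gtr0_real //.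
move=> [c Fc]; split=> //; apply/(linear_bounded_continuous f)/linear_boundedP.
near=> r => x; apply: le_trans (Fc x) _.
rewrite ler_wpM2r //; near: r; apply: nbhs_pinfty_ge.
by apply/complex_realP; exists c.
Unshelve. all: by end_near. Qed.

Lemma Re_normK H (x : H) : (complex.Re `|x|)%:C = `|x|.
Proof. by rewrite RRe_real ?normr_real. Qed.

Lemma Re_norm_ge0 H (x : H) : 0 <= complex.Re `|x|.
Proof. by rewrite -ler0c Re_normK. Qed.

Lemma opnorm_le U V (F : U -> V) (c : R) :
  0 <= c -> (forall x, `|F x| <= c%:C * `|x|) -> opnorm F <= c.
Proof.
move=> c0 Fc; apply: ge_sup.
  by exists (complex.Re `|F 0|), 0 => //=; rewrite normr0.
move=> _ [x /= x1 <-]; rewrite -lecR Re_normK.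
by apply: le_trans (Fc x) _; rewrite ler_piMr ?ler0c.
Qed.

Lemma le_opnorm_unit U V (F : U -> V) x :
  bounded_operators U V F -> `|x| <= 1 -> complex.Re `|F x| <= opnorm F.
Proof.
move=> /bounded_operatorP[_ [c Fc]] x1; apply: ub_le_sup; last by exists x.
(* When [U] is the zero space [c] may be negative, so the upper bound is its absolute value. *)
exists `|c| => _ [z /= z1 <-]; rewrite -lecR Re_normK.
apply: le_trans (Fc z) _; apply: (@le_trans _ _ (`|c|%:C * `|z|)).
  by rewrite ler_wpM2r // lecR ler_norm.
by rewrite ler_piMr // ler0c.
Qed.

Lemma le_opnorm U V (F : U -> V) x :
  bounded_operators U V F -> `|F x| <= (opnorm F)%:C * `|x|.
Proof.
move=> bF; have [FL _] := bF.
have [->|x0] := eqVneq x 0.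
  by rewrite (linear_fun0 FL) !normr0 mulr0.
have nx0 : 0 < `|x| by rewrite normr_gt0.
pose y := `|x|^-1 *: x.
have y1 : `|y| = 1 by rewrite normrZ gtr0_norm ?invr_gt0 // mulVf // gt_eqF.
have -> : F x = `|x| *: F y.
  by rewrite (linear_funZ _ _ FL) scalerA divff ?scale1r // gt_eqF.
rewrite normrZ (gtr0_norm nx0) mulrC ler_pM2r // -Re_normK lecR.
by apply: le_opnorm_unit; rewrite ?y1.
Qed.

Lemma opnorm_ge0 U V (F : U -> V) : bounded_operators U V F -> 0 <= opnorm F.
Proof.
move=> bF; apply: le_trans (Re_norm_ge0 (F 0)) _.
by apply: le_opnorm_unit; rewrite ?normr0.
Qed.

(* X is automatically finite-dimensional: the matrix coefficients of [S x] in a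
   spanning family of V separate the points of X, so [x] is a combination of
   fixed vectors with these coefficients as weights, and Cauchy-Schwarz bounds
   each of them by the operator norm. This replaces a compactness argument. *)
Lemma opnorm_bounded_below X V (S : X -> V -> V) :
  finite_dimensional V -> linear S ->
  (forall x, bounded_operators V V (S x)) -> (forall x, S x = 0 -> x = 0) ->
  exists2 m : R, 0 < m & forall x, m * complex.Re `|x| <= opnorm (S x).
Proof.
move=> [n [e espan]] SL bS Sker.
pose psi (ij : 'I_n * 'I_n) x : R[i] := inner (S x (e ij.1)) (e ij.2).
have psiL ij : linear_for *%R (psi ij).
  by move=> a u v; rewrite /psi SL linearPl.
have idL : linear (@id X) by [].
have psi_inj x : (forall ij, psi ij x = 0) -> x = 0.
  move=> psi0; apply: Sker; apply/funext => v.
  have [SxL _] := bS x; have [c ->] := espan v.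
  rewrite (linear_fun_sum _ SxL) big1 // => i _.
  rewrite (linear_funZ _ _ SxL).
  suff -> : S x (e i) = 0 by rewrite scaler0.
  apply: inner_inj => w; rewrite linear0r innerC.
  have [d ->] := espan w.
  rewrite linear_sumr /= big1 ?rmorph0 // => j _.
  by rewrite linearZr_LR /= [inner _ _](psi0 (i, j)) mulr0.
have [z zE] := factor_through_functionals psiL idL psi_inj.
pose C := \sum_ij `|e ij.1| * `|e ij.2| * `|z ij|.
have C0 : 0 <= C by apply: sumr_ge0 => ij _; rewrite !mulr_ge0.
have xC x : `|x| <= (opnorm (S x))%:C * C.
  rewrite {1}[x]zE (le_trans (ler_norm_sum _ _ _)) // mulr_sumr.
  rewrite ler_sum // => ij _.
  rewrite normrZ !mulrA ler_wpM2r //.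
  apply: le_trans (cauchy_schwarz _ _) _; rewrite ler_wpM2r //.
  exact: le_opnorm.
have ReC : (complex.Re C)%:C = C by rewrite RRe_real // ger0_real.
(* [C] may vanish, so 1 is added before inverting. *)
have C1 : 0 < complex.Re C + 1.
  by rewrite ltr_wpDl // -ler0c ReC.
exists (complex.Re C + 1)^-1; first by rewrite invr_gt0.
move=> x; rewrite mulrC ler_pdivrMr //.
have := xC x; rewrite -ReC -(Re_normK x) -rmorphM lecR => /le_trans; apply.
by rewrite ler_wpM2l ?opnorm_ge0 // ler_wpDr.
Qed.

(** Each projector fixes the common range pointwise, so [Q \o P = P] and [P \o Q = Q];
    self-adjointness then identifies the two. *)
Lemma orthogonal_projector_unique H (A : set H) (P Q : H -> H) :
  orthogonal_projector A P -> orthogonal_projector A Q -> P = Q.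
Proof.
move=> [_ PP Pa PA] [_ QQ Qa QA].
have fix_range (S T : H -> H) : S \o S = S -> range S = range T ->
    forall y, S (T y) = T y.
  move=> SS ST y; have : range S (T y) by rewrite ST; exists y.
  by move=> [z _ <-]; exact: (congr1 (@^~ z) SS).
have QP := fix_range Q P QQ (etrans QA (esym PA)).
have PQ := fix_range P Q PP (etrans PA (esym QA)).
apply/funext => y; apply: inner_inj => x.
by rewrite -Pa -(QP x) Qa Pa PQ.
Qed.

End HilbertSpace.

(** * Compression of operators along an equivariant isometric embedding *)

Section Compression.
Variables (R : realType) (G : groupType) (V H : hilbertType R).
Variables (rhoV : representation G V) (rhoH : representation G H).
Hypotheses (unitV : unitary rhoV) (unitH : unitary rhoH).
Variables (U : V -> H) (Ud : H -> V).
Hypotheses (U_linear : linear U) (UUd : is_adjoint U Ud) (UdU : Ud \o U = id).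
Hypothesis (U_equiv : equivariant rhoV rhoH U).

Let UdUK v : Ud (U v) = v. Proof. exact: (congr1 (@^~ v) UdU). Qed.

Let U_equivE g v : U (rhoV g v) = rhoH g (U v).
Proof. exact: (congr1 (@^~ v) (U_equiv g)). Qed.

Definition compress (F : H -> H) : V -> V := Ud \o F \o U.

Let Ud_linear : linear Ud. Proof. exact: adjoint_linear UUd. Qed.

Lemma isometry_norm v : `|U v| = `|v|.
Proof. by apply/eqP; rewrite -(@eqrXn2 _ 2) // -!innerE UUd UdUK. Qed.

(** By Pythagoras, the squared norm of [y - U (Ud y)] is the difference of the two squared norms. *)
Lemma isometry_adjoint_norm y : `|Ud y| <= `|y|.
Proof.
rewrite -(@ler_pXn2r _ 2) ?nnegrE // -subr_ge0 -!innerE.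
have := dnorm_ge0 inner (y - U (Ud y)).
rewrite dnormB UUd UdUK.
have -> : inner y (U (Ud y)) = inner (Ud y) (Ud y) by rewrite (adjointC UUd).
by rewrite innerE conj_Creal ?rpredX ?normr_real // opprD addrA addrK.
Qed.

Lemma compress_linear : linear compress.
Proof. by move=> a E F; apply/funext => v; exact: Ud_linear. Qed.

Lemma norm_compress_le F v :
  bounded_operators H H F -> `|compress F v| <= (opnorm F)%:C * `|v|.
Proof.
move=> bF; apply: le_trans (isometry_adjoint_norm _) _.
by rewrite -isometry_norm le_opnorm.
Qed.

Lemma compress_bounded F :
  bounded_operators H H F -> bounded_operators V V (compress F).
Proof.
move=> bF; apply/bounded_operatorP; split; last first.
  by exists (opnorm F) => v; exact: norm_compress_le.
by have [FL _] := bF; move=> a u v; rewrite /compress /= U_linear FL Ud_linear.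
Qed.

Lemma opnorm_compress_le F :
  bounded_operators H H F -> opnorm (compress F) <= opnorm F.
Proof.
by move=> bF; apply: opnorm_le (opnorm_ge0 bF) _ => v; exact: norm_compress_le.
Qed.

(** Take adjoints in the equivariance of [U] at the inverse of [g]: unitarity of both
    representations turns inverses into adjoints. *)
Lemma adjoint_equivariant : equivariant rhoH rhoV Ud.
Proof.
move=> g; apply/funext => y; apply: inner_inj => v /=.
rewrite -UUd -(adjointC (unitH g)) -U_equivE UUd.
by rewrite (adjointC (unitV g)).
Qed.

Lemma compress_conj g F :
  compress (conj_action rhoH g F) = conj_action rhoV g (compress F).
Proof.
apply/funext => v; rewrite /compress /conj_action /=.
rewrite U_equivE.
exact: (congr1 (@^~ _) (adjoint_equivariant g)).
Qed.

Lemma projector_image (I : set V) (Omega : V -> V) :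
  orthogonal_projector I Omega ->
  orthogonal_projector (U @` I) (U \o Omega \o Ud).
Proof.
move=> [bO OO Oa OI]; split.
- apply/bounded_operatorP; split.
    by have [OL _] := bO; move=> a u v; rewrite /= Ud_linear OL U_linear.
  exists (opnorm Omega) => y; rewrite /= isometry_norm.
  apply: le_trans (le_opnorm _ bO) _.
  by rewrite ler_wpM2l ?ler0c ?opnorm_ge0 ?isometry_adjoint_norm.
- by apply/funext => y /=; rewrite UdUK; congr (U _); exact: (congr1 (@^~ _) OO).
- by move=> x y /=; rewrite UUd Oa (adjointC UUd).
- rewrite -OI; apply/seteqP; split => z /=.
    by move=> [y _ <-]; exists (Omega (Ud y)) => //; exists (Ud y).
  by move=> [_ [v _ <-] <-]; exists (U v) => //=; rewrite UdUK.
Qed.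

Variables (X : hilbertType R) (xi : representation G X).
Hypotheses (finV : finite_dimensional V) (irr_xi : irreducible_rep xi).

(** Schur's lemma for [S], the parametrization [T] of [K] followed by compression. Its kernel is
    closed and invariant, so [S] is zero or injective; if injective, its range is a copy of [xi]
    among the operators on [V]. *)
Lemma compress_irreducible (K : set (H -> H)) (F : H -> H) :
  operator_subrep rhoH K -> isomorphic_to_subrep xi rhoH K -> K F ->
  compress F = 0 \/ isotypic xi rhoV (compress F).
Proof.
move=> [_ Kb _] [T [TL [TK _ Tonto] Tconj [m [M [_ Tnorm]]]]] KF.
pose S x := compress (T x).
have SL : linear S by move=> a u v; rewrite /S TL compress_linear.
have Tb x : bounded_operators H H (T x) by apply/Kb/TK.
have Sb x : bounded_operators V V (S x) by exact: compress_bounded.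
have Sconj g x : S (xi g x) = conj_action rhoV g (S x).
  by rewrite /S Tconj compress_conj.
have TM x : opnorm (T x) <= M * complex.Re `|x| by have /andP[] := Tnorm x.
have [x _ <-] := Tonto _ KF.
have kerL : linear_subspace [set x | S x = 0].
  split=> [|a u v /= Su Sv]; first exact: linear_fun0.
  by rewrite SL Su Sv scaler0 addr0.
have kerC : closed [set x | S x = 0].
  (* Closedness is checked one vector [v] at a time, through the continuity of evaluation at [v]. *)
  have -> : [set x | S x = 0] = \bigcap_v ((fun x => S x v) @^-1` [set 0]).
    apply/seteqP; split => [y Sy v _|y Sy]; first by rewrite /= (Sy : S y = 0).
    by apply/funext => v; exact: Sy.
  apply: closed_bigI => v _; apply: preimage_closed => [z _|]; last first.
    apply: accessible_closed_set1; apply: hausdorff_accessible.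
    exact: norm_hausdorff.
  suff [_] : bounded_operators X V (fun x => S x v) by apply.
  apply/bounded_operatorP; split=> [a u w|]; first by rewrite SL.
  exists (M * complex.Re `|v|) => {}y.
  apply: le_trans (norm_compress_le _ (Tb y)) _.
  rewrite -(Re_normK v) -(Re_normK y) -!rmorphM lecR mulrAC.
  by rewrite ler_wpM2r ?Re_norm_ge0.
have kerG g y : S y = 0 -> S (xi g y) = 0.
  move=> Sy; rewrite Sconj Sy; apply/funext => v.
  by rewrite /conj_action /= (linear_fun0 (rep_bounded rhoV g).1).
have [ker0|kerT] := irr_xi.2 _ kerL kerC kerG; last first.
  by left; have : [set: X] x by []; rewrite -kerT.
right; exists 1%N, (fun=> S x); split=> [_|]; last by rewrite big_ord1.
exists (range S); last by exists x.
have S_eq0 y : S y = 0 -> y = 0.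
  by move=> Sy; have : [set x | S x = 0] y by []; rewrite ker0.
split; first split.
- split=> [|a _ _ [u _ <-] [v _ <-]]; first by exists 0; rewrite ?linear_fun0.
  by exists (a *: u + v); rewrite ?SL.
- by move=> _ [y _ <-].
- by move=> g _ [y _ <-]; exists (xi g y).
exists S; split=> //.
  split=> [y _|y z _ _ Syz|_ [y _ <-]]; [by exists y| |by exists y].
  apply/eqP; rewrite -subr_eq0; apply/eqP/S_eq0.
  by rewrite addrC -scaleN1r SL Syz scaleN1r addNr.
(* The lower bound comes from injectivity and the finite dimension of [V]; the upper bound [M] is
   inherited from [T], as compression does not increase the operator norm. *)
have [c c0 Sc] := opnorm_bounded_below finV SL Sb S_eq0.
exists c, M; split=> // y; rewrite Sc /=.
exact: le_trans (opnorm_compress_le (Tb y)) (TM y).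
Qed.

End Compression.

Theorem lemma1 (R : realType) (G : groupType)
    (V : hilbertType R) (rhoV : representation G V)
    (finV : finite_dimensional V) (unitV : unitary rhoV)
    (X : hilbertType R) (xi : representation G X) (irr_xi : irreducible_rep xi)
    (I : set V) (subI : linear_subspace I)
    (Omega : V -> V) (projI : orthogonal_projector I Omega)
    (KL_I : Knill_Laflamme Omega (isotypic xi rhoV)) :
  forall (H : hilbertType R) (rhoH : representation G H), unitary rhoH ->
  forall U : V -> H, isometric_embedding U -> equivariant rhoV rhoH U ->
  forall Pi : H -> H, orthogonal_projector (U @` I) Pi ->
  Knill_Laflamme Pi (isotypic xi rhoH).
Proof.
move=> H rhoH unitH U [UL [Ud UUd UdU]] U_equiv Pi projPi _ [n [f [fK ->]]].
have -> : Pi = U \o Omega \o Ud.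
  exact: orthogonal_projector_unique projPi (projector_image UL UUd UdU projI).
have [[OL _] _ _ _] := projI; have UdL := adjoint_linear UUd.
(* Each summand [f i] lies in a copy of [xi], so its compression is either zero, with scalar 0, or
   in [isotypic xi rhoV], where [KL_I] provides the scalar. *)
have /choice[c fc] i : exists c : R[i],
    Omega \o compress U Ud (f i) \o Omega = c *: Omega.
  have [K [Ksub Kiso] KF] := fK i.
  have [->|] := compress_irreducible unitV unitH UL UUd UdU U_equiv finV irr_xi
    Ksub Kiso KF; last exact: KL_I.
  by exists 0; apply/funext => v; rewrite /= scale0r linear_fun0.
(* The error is a finite sum of the [f i], so by linearity the scalars add up. *)
exists (\sum_i c i); apply/funext => y.
have sumE m (h : 'I_m -> H -> H) z : (\sum_i h i) z = \sum_i h i z.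
  by elim/big_rec2: _ => // i a b _ <-.
have fcE i : Omega (Ud (f i (U (Omega (Ud y))))) = c i *: Omega (Ud y).
  exact: (congr1 (@^~ (Ud y)) (fc i)).
rewrite /= sumE (linear_fun_sum _ UdL) (linear_fun_sum _ OL).
rewrite (linear_fun_sum _ UL).
rewrite (eq_bigr (fun i => c i *: U (Omega (Ud y)))) => [|i _]; last first.
  by rewrite -(linear_funZ _ _ UL) -fcE.
by rewrite -scaler_suml.
Qed.
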